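(* Let $(\mathcal{X},\mathcal{Y})$ be a continuous biframe Bessel mapping for $\mathcal{H}$ with respect to $(\Omega,\mu)$, with Bessel bound $B$, and let $0<A\le B$. Then $(\mathcal{X},\mathcal{Y})$ is a continuous biframe for $\mathcal{H}$ with bounds $A$ and $B$ if and only if $S_{\mathcal{X},\mathcal{Y}}\ge A I$, where $S_{\mathcal{X},\mathcal{Y}}$ is the continuous biframe operator of $(\mathcal{X},\mathcal{Y})$ and $I$ is the identity operator on $\mathcal{H}$.
   Context: $\mathcal{A}$ is a unital $C^*$-algebra, $\mathcal{H}$ is a (left) Hilbert $\mathcal{A}$-module with $\mathcal{A}$-valued inner product $\langle\cdot,\cdot\rangle_{\mathcal{A}}$ ($\mathcal{A}$-linear in the first variable), and $(\Omega,\mu)$ is a measure space with positive measure. Inequalities between elements of $\mathcal{A}$ refer to the usual order of self-adjoint elements; integrals of $\mathcal{A}$-valued and $\mathcal{H}$-valued functions are Banach-space-valued (Bochner type) integrals. A pair $(\mathcal{X},\mathcal{Y})$ of mappings $\mathcal{X},\mathcal{Y}:\Omega\to\mathcal{H}$ is a continuous biframe for $\mathcal{H}$ with respect to $(\Omega,\mu)$ with bounds $0<A\le B<\infty$ if (i) for all $f\in\mathcal{H}$ the functions $\omega\mapsto\langle f,\mathcal{X}(\omega)\rangle_{\mathcal{A}}$ and $\omega\mapsto\langle f,\mathcal{Y}(\omega)\rangle_{\mathcal{A}}$ are measurable on $\Omega$, and (ii) for all $f\in\mathcal{H}$, $$A\langle f,f\rangle_{\mathcal{A}}\le\int_\Omega\langle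 f,\mathcal{X}(\omega)\rangle_{\mathcal{A}}\langle\mathcal{Y}(\omega),f\rangle_{\mathcal{A}}\,d\mu\le B\langle f,f\rangle_{\mathcal{A}}.$$ If only the right-hand inequality in (ii) is required, $(\mathcal{X},\mathcal{Y})$ is a continuous biframe Bessel mapping with Bessel bound $B$. The continuous biframe operator is $S_{\mathcal{X},\mathcal{Y}}:\mathcal{H}\to\mathcal{H}$, $S_{\mathcal{X},\mathcal{Y}}f=\int_\Omega\langle f,\mathcal{X}(\omega)\rangle_{\mathcal{A}}\mathcal{Y}(\omega)\,d\mu$, so that $\langle S_{\mathcal{X},\mathcal{Y}}f,f\rangle_{\mathcal{A}}=\int_\Omega\langle f,\mathcal{X}(\omega)\rangle_{\mathcal{A}}\langle\mathcal{Y}(\omega),f\rangle_{\mathcal{A}}\,d\mu$. The relation $S_{\mathcal{X},\mathcal{Y}}\ge AI$ means $\langle S_{\mathcal{X},\mathcal{Y}}f,f\rangle_{\mathcal{A}}\ge A\langle f,f\rangle_{\mathcal{A}}$ for all $f\in\mathcal{H}$. *)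

(* Defs.v *)
From HB Require Import structures.
From mathcomp Require Import all_boot all_order all_algebra.
From mathcomp Require Import complex.
From mathcomp Require Import all_classical all_reals all_analysis.

Set Implicit Arguments.
Unset Strict Implicit.
Unset Printing Implicit Defensive.

Import Order.TTheory GRing.Theory Num.Theory.
Import numFieldNormedType.Exports.

Local Open Scope classical_set_scope.
Local Open Scope complex_scope.
Local Open Scope ring_scope.

(* Hierarchy Builder rejects a join of MathComp's rings with its normed modules
   (both are inherited by numDomainType), so the product [amul] and the unit
   [aone] are fields of the mixin.  The zero algebra is allowed. *)
HB.mixin Record isCStarAlgebra (R : realType) T
    of CompleteNormedModule R[i] T := {
  amul : T -> T -> T;
  aone : T;
  star : T -> T;
  amulA : forall a b c : T, amul a (amul b c) = amul (amul a b) c;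
  amul1l : forall a : T, amul aone a = a;
  amul1r : forall a : T, amul a aone = a;
  amulDl : forall a b c : T, amul (a + b) c = amul a c + amul b c;
  amulDr : forall a b c : T, amul a (b + c) = amul a b + amul a c;
  ascaleAl : forall (l : R[i]) (a b : T), l *: amul a b = amul (l *: a) b;
  ascaleAr : forall (l : R[i]) (a b : T), l *: amul a b = amul a (l *: b);
  starK : forall a : T, star (star a) = a;
  starD : forall a b : T, star (a + b) = star a + star b;
  starZ : forall (l : R[i]) (a : T), star (l *: a) = Num.conj l *: star a;
  starM : forall a b : T, star (amul a b) = amul (star b) (star a);
  anormM : forall a b : T, `|amul a b| <= `|a| * `|b|;
  cstar_identity : forall a : T, `|amul (star a) a| = `|a| ^+ 2
}.

#[short(type="cstarAlgType")]
HB.structure Definition CStarAlgebra (R : realType) :=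
  {T of CompleteNormedModule R[i] T & isCStarAlgebra R T}.

Notation "a ** b" := (amul a b)
  (at level 40, left associativity) : ring_scope.

Section CStarOrder.
Context {R : realType} {A : cstarAlgType R}.

Definition spectrum (a : A) : set R[i] :=
  [set l | ~ exists b : A,
             b ** (l *: aone - a) = aone /\ (l *: aone - a) ** b = aone].

(* [0 <= l] in R[i] means that l is real and nonnegative. *)
Definition cstar_pos (a : A) : Prop :=
  star a = a /\ forall l, spectrum a l -> 0 <= l.

Definition cstar_le (a b : A) : Prop := cstar_pos (b - a).

End CStarOrder.

(* H carries a single MathComp module structure, over R[i]; the left action of
   A is the operation [hact], so that its compatibility with the complex
   scaling is an explicit law. *)
HB.mixin Record isHilbertModule (R : realType) (A : cstarAlgType R) H
    of CompleteNormedModule R[i] H := {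
  hact : A -> H -> H;
  hactDl : forall (a b : A) (x : H), hact (a + b) x = hact a x + hact b x;
  hactDr : forall (a : A) (x y : H), hact a (x + y) = hact a x + hact a y;
  hactA : forall (a b : A) (x : H), hact (a ** b) x = hact a (hact b x);
  hact1 : forall x : H, hact aone x = x;
  hactZ : forall (l : R[i]) (a : A) (x : H), hact (l *: a) x = l *: hact a x;
  inner : H -> H -> A;
  innerDl : forall x y z : H, inner (x + y) z = inner x z + inner y z;
  inner_hact : forall (a : A) (x y : H), inner (hact a x) y = a ** inner x y;
  inner_star : forall x y : H, star (inner x y) = inner y x;
  inner_ge0 : forall x : H, cstar_pos (inner x x);
  inner_eq0 : forall x : H, inner x x = 0 -> x = 0;
  hnormE : forall x : H, `|x| ^+ 2 = `|inner x x|
}.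

#[short(type="hilbertModType")]
HB.structure Definition HilbertModule (R : realType) (A : cstarAlgType R) :=
  {H of CompleteNormedModule R[i] H & isHilbertModule R A H}.

Section Bochner.
Context {R : realType} {d : measure_display} {T : measurableType d}.
Variable mu : {measure set T -> \bar R}.
Context {V : completeNormedModType R[i]}.

Definition simple_integrable (s : T -> V) : Prop :=
  [/\ finite_set (range s),
      forall v, measurable (s @^-1` [set v]) &
      forall v, v != 0 -> (mu (s @^-1` [set v]) < +oo)%E].

Definition simple_integral (s : T -> V) : V :=
  \sum_(v \in [set: V]) (fine (mu (s @^-1` [set v])))%:C *: v.

Definition strongly_measurable (f : T -> V) : Prop :=
  exists2 s : nat -> T -> V, (forall n, simple_integrable (s n)) &
    {ae mu, forall x, s n x @[n --> \oo] --> f x}.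

(* Norms over R[i] take values in R[i], hence the real part. *)
Definition L1_approx (f : T -> V) (s : nat -> T -> V) : Prop :=
  (forall n, simple_integrable (s n)) /\
  (\int[mu]_x (complex.Re `|f x - s n x|)%:E)%E @[n --> \oo] --> 0%E.

Definition bochner_integrable (f : T -> V) : Prop :=
  strongly_measurable f /\ exists s, L1_approx f s.

(* Meaningful only when f is Bochner integrable. *)
Definition bochner_integral (f : T -> V) : V :=
  xget 0 [set v | exists2 s, L1_approx f s &
                  simple_integral (s n) @[n --> \oo] --> v].

End Bochner.

Section Biframe.
Context {R : realType} {A : cstarAlgType R} {H : hilbertModType A}.
Context {d : measure_display} {Omega : measurableType d}.
Variable mu : {measure set Omega -> \bar R}.

(* Measurability with respect to the Borel sigma-algebra of the norm of A. *)
Definition coef_measurable (X : Omega -> H) : Prop :=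
  forall f : H, measurable_fun [set: Omega]
    ((fun w => inner f (X w)) : Omega -> g_sigma_algebraType (@open A)).

Definition biframe_integrand (X Y : Omega -> H) (f : H) : Omega -> A :=
  fun w => inner f (X w) ** inner (Y w) f.

Definition is_biframe_bessel (X Y : Omega -> H) (b : R) : Prop :=
  [/\ 0 < b, coef_measurable X, coef_measurable Y &
      forall f : H, bochner_integrable mu (biframe_integrand X Y f) /\
        cstar_le (bochner_integral mu (biframe_integrand X Y f))
                 (b%:C *: inner f f)].

Definition is_biframe (X Y : Omega -> H) (a b : R) : Prop :=
  [/\ 0 < a <= b, coef_measurable X, coef_measurable Y &
      forall f : H,
        [/\ bochner_integrable mu (biframe_integrand X Y f),
            cstar_le (a%:C *: inner f f)
                     (bochner_integral mu (biframe_integrand X Y f)) &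
            cstar_le (bochner_integral mu (biframe_integrand X Y f))
                     (b%:C *: inner f f)]].

(* The integral defining S f is required to exist for every f. *)
Definition is_biframe_operator (X Y : Omega -> H) (S : H -> H) : Prop :=
  forall f : H,
    bochner_integrable mu (fun w => hact (inner f (X w)) (Y w)) /\
    S f = bochner_integral mu (fun w => hact (inner f (X w)) (Y w)).

Definition operator_ge_scalar (S : H -> H) (a : R) : Prop :=
  forall f : H, cstar_le (a%:C *: inner f f) (inner (S f) f).

End Biframe.

(* Main.v *)
From HB Require Import structures.
Require Import Defs.
From mathcomp Require Import all_boot all_order all_algebra.
From mathcomp Require Import finmap complex.
From mathcomp Require Import all_classical all_reals all_analysis.
From mathcomp Require Import measurable_realfun lra.

Set Implicit Arguments.
Unset Strict Implicit.
Unset Printing Implicit Defensive.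

Import Order.TTheory GRing.Theory Num.Theory.
Import numFieldNormedType.Exports.

Local Open Scope classical_set_scope.
Local Open Scope complex_scope.
Local Open Scope ring_scope.

(** The lower bound in the definition of a biframe speaks of the integral of
    <f, X> <Y, f>, the condition on S speaks of <S f, f>.  The two coincide, for
    <f, X> <Y, f> = <g, f> with g = <f, X> Y, and the linear map <., f> can be
    moved across the Bochner integral of g that defines S f
    ([inner_biframe_operator]); the equivalence is then immediate.

    Moving a linear map L across a Bochner integral ([bochner_integral_linear])
    needs L to be bounded.  For L = <., f> this follows by polarization from
    |<x, x>| = |x|^2 and the triangle inequality of the norm of H
    ([inner_bounded]).

    Given simple functions s_n that approximate a Bochner integrable g in L1,
    the functions L o s_n approximate L o g, and the integral of L o s_n is L of
    the integral of s_n.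
    What remains is that the Bochner integral is well defined: the integrals of
    the s_n converge ([L1_approx_cvg]), and to a limit that does not depend on
    the approximation ([L1_approx_lim_unique]).  Both come from
    |I s - I t| <= \int |g - s| + \int |g - t|, where I s and I t are the
    integrals of simple functions s and t ([simple_integral_dist]).
    The point there is that mu need not be complete, so that g, a limit almost
    everywhere of simple functions, need not be measurable; the integral of
    |g - s| is a supremum over simple functions below |g - s|, and such a lower
    integral is not subadditive in general.  It is here because |g - s| agrees
    almost everywhere with a measurable function
    ([strongly_measurable_dist]). *)

(** * The norm as a real number *)

Section RealNorm.
Context {R : realType} {V : normedModType R[i]}.
Implicit Types x y : V.

(** The norm of a module over R[i] is a complex number; its real part can enter
    the Lebesgue integral and the order tactics of R. *)
Definition rnorm x : R := complex.Re `|x|.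

Lemma rnormE x : `|x| = (rnorm x)%:C.
Proof. by rewrite /rnorm RRe_real// ger0_real. Qed.

Lemma rnorm_ge0 x : 0 <= rnorm x.
Proof. by rewrite -lecR -rnormE normr_ge0. Qed.

Lemma rnorm0 : rnorm 0 = 0.
Proof. by rewrite /rnorm normr0. Qed.

Lemma rnorm_sub x y : rnorm (x - y) = rnorm (y - x).
Proof. by rewrite /rnorm distrC. Qed.

Lemma rnormN x : rnorm (- x) = rnorm x.
Proof. by rewrite /rnorm normrN. Qed.

Lemma rnorm_iZ x : rnorm ('i *: x) = rnorm x.
Proof. by rewrite /rnorm normrZ normCi mul1r. Qed.

Lemma ler_rnormD x y : rnorm (x + y) <= rnorm x + rnorm y.
Proof. by rewrite -lecR rmorphD /= -!rnormE ler_normD. Qed.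

Lemma rnorm_dist x y : `|rnorm x - rnorm y| <= rnorm (x - y).
Proof.
have h (u v : V) : rnorm u - rnorm v <= rnorm (u - v).
  by rewrite lerBlDr -{1}(subrK v u) ler_rnormD.
by rewrite ler_norml lerNl opprB rnorm_sub h rnorm_sub h.
Qed.

Lemma rnormZ (k : R) x : rnorm (k%:C *: x) = `|k| * rnorm x.
Proof.
apply: (@complexI R); rewrite rmorphM /= -!rnormE normrZ normc_def /=.
by rewrite expr0n addr0 sqrtr_sqr rnormE.
Qed.

Lemma ler_rnorm_sum (I : Type) (r : seq I) (F : I -> V) :
  rnorm (\sum_(i <- r) F i) <= \sum_(i <- r) rnorm (F i).
Proof.
elim/big_rec2: _ => [|i y x _ h]; first by rewrite rnorm0.
by apply: le_trans (ler_rnormD _ _) _; rewrite lerD2l.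
Qed.

Lemma gt0_complexP (e : R[i]) : 0 < e -> exists2 r : R, 0 < r & e = r%:C.
Proof.
case: e => r m; rewrite ltcE /= => /andP[/eqP -> r0]; exists r => //.
Qed.

Lemma cvg_rnormP (T : Type) (F : set_system T) (FF : Filter F)
    (u : T -> V) (l : V) :
  (u t @[t --> F] --> l) <-> (rnorm (l - u t) @[t --> F] --> (0 : R)).
Proof.
split.
  move=> /cvgrPdist_lt ul; apply/cvgrPdist_lt => e e0.
  have := ul e%:C; rewrite ltcR => /(_ e0); apply: filterS => t.
  by rewrite rnormE ltcR sub0r normrN ger0_norm// rnorm_ge0.
move=> /cvgrPdist_lt ul; apply/cvgrPdist_lt => _ /gt0_complexP[e e0 ->].
have := ul e e0; apply: filterS => t.
by rewrite rnormE ltcR sub0r normrN ger0_norm// rnorm_ge0.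
Qed.

End RealNorm.

Lemma cauchy_rnorm_cvg (R : realType) (V : completeNormedModType R[i])
    (u : nat -> V) (e_ : nat -> R) (N0 : nat) :
  e_ n @[n --> \oo] --> 0 ->
  (forall n m, (N0 <= n)%N -> (N0 <= m)%N ->
    rnorm (u n - u m) <= e_ n + e_ m) ->
  cvgn u.
Proof.
move=> e0 hu; apply: cauchy_cvg.
apply: cauchy_exP => _ /gt0_complexP[e egt0 ->].
have e20 : 0 < e / 2 by rewrite divr_gt0.
have /cvgrPdist_lt/(_ _ e20) [N1 _ he] := e0.
have small n : (N1 <= n)%N -> e_ n < e / 2.
  by move=> /he /=; rewrite sub0r normrN; apply: le_lt_trans; exact: ler_norm.
exists (u (maxn N0 N1)); exists (maxn N0 N1) => // m /=.
rewrite geq_max => /andP[m0 m1].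
rewrite -ball_normE /= rnormE ltcR.
apply: le_lt_trans (hu _ _ (leq_maxl _ _) m0) _.
by rewrite [e in ltRHS]splitr ltrD// small// leq_maxr.
Qed.

(** * Maps with finitely many measurable fibres *)

Section FiniteMaps.
Context {R : realType} {d : measure_display} {T : measurableType d}.
Variable mu : {measure set T -> \bar R}.

(** The first two clauses of [simple_integrable], for an arbitrary codomain:
    pairs of simple functions are such maps. *)
Definition finite_map (U : Type) (p : T -> U) : Prop :=
  finite_set (range p) /\ forall u, measurable (p @^-1` [set u]).

Lemma preimage_range_bigcup (U : choiceType) (p : T -> U) (B : set U) :
  p @^-1` B = \bigcup_(u in range p `&` B) (p @^-1` [set u]).
Proof.
apply/seteqP; split => x /=.
  by move=> Bx; exists (p x) => //; split => //; exists x.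
by move=> [u [_ Bu] /= ->].
Qed.

Lemma measurable_finite_map (U : choiceType) (p : T -> U) (B : set U) :
  finite_map p -> measurable (p @^-1` B).
Proof.
move=> [fp mp]; rewrite preimage_range_bigcup.
by apply: fin_bigcup_measurable => //; exact: finite_setIl.
Qed.

Lemma finite_map_comp (U W : choiceType) (p : T -> U) (h : U -> W) :
  finite_map p -> finite_map (h \o p).
Proof.
move=> hp; split; last first.
  by move=> u; exact: (measurable_finite_map (h @^-1` [set u]) hp).
have -> : range (h \o p) = h @` (range p).
  apply/seteqP; split => [_ [x _ <-]|_ [_ [x _ <-] <-]] /=; last by exists x.
  by exists (p x) => //; exists x.
by apply: finite_image; case: hp.
Qed.

Lemma finite_map_pair (U W : choiceType) (p : T -> U) (q : T -> W) :
  finite_map p -> finite_map q -> finite_map (fun x => (p x, q x)).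
Proof.
move=> [fp mp] [fq mq]; split.
  apply: sub_finite_set (finite_setX fp fq) => _ [x _ <-].
  by split => /=; exists x.
move=> [u v]; rewrite (_ : _ @^-1` _ = p @^-1` [set u] `&` q @^-1` [set v]).
  exact: measurableI.
by apply/seteqP; split => [x /= [-> ->]|x /= [-> ->]].
Qed.

Lemma mu_finite_preimage (U : choiceType) (p : T -> U) (P : pred U) :
  finite_map p ->
  mu (p @^-1` [set u | P u]) =
  (\sum_(u <- fset_set (range p) | P u) mu (p @^-1` [set u]))%E.
Proof.
move=> [fp mp]; rewrite preimage_range_bigcup.
rewrite measure_fin_bigcup//; last 2 first.
- exact: finite_setIl.
- apply/trivIsetP => u v _ _ uv; apply/seteqP; split => // x /= [/= -> ] /eqP.
  by rewrite (negbTE uv).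
rewrite fsbig_mkcondr fsbig_finite// [RHS]big_mkcond.
by apply: eq_bigr => u _; rewrite mem_setE.
Qed.

(** The integral of [h \o p] computed over the fibres of [p], which are finer
    than those of [h \o p].  Linearity of the integral follows by taking for [p]
    a simple function, or a pair of simple functions, and for [h] the linear
    map or the difference. *)
Lemma simple_integral_comp (V : completeNormedModType R[i]) (U : choiceType)
    (p : T -> U) (h : U -> V) :
  finite_map p ->
  (forall u, h u != 0 -> (mu (p @^-1` [set u]) < +oo)%E) ->
  simple_integral mu (h \o p) =
  \sum_(u <- fset_set (range p)) (fine (mu (p @^-1` [set u])))%:C *: h u.
Proof.
move=> hp hfin; have [fp mp] := hp.
have fhp := (finite_map_comp h hp).1.
rewrite /simple_integral.
set E := fset_set (range p); set F := fset_set (range (h \o p)).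
have hE u : u \in E -> h u \in F.
  by rewrite !in_fset_set// !inE => -[x _ <-]; exists x.
transitivity (\sum_(v <- F) (fine (mu ((h \o p) @^-1` [set v])))%:C *: v).
  rewrite (fsbigE F) => //.
    by apply: eq_bigl => v; rewrite in_setT.
  move=> v _ vF; rewrite (_ : _ @^-1` _ = set0) ?measure0 ?scale0r//.
  apply/seteqP; split => // x /= hv; move: vF.
  by rewrite in_fset_set// notin_setE; apply; exists x.
have step v : (fine (mu ((h \o p) @^-1` [set v])))%:C *: v =
   \sum_(u <- E | h u == v) (fine (mu (p @^-1` [set u])))%:C *: h u.
  have [->|v0] := eqVneq v 0.
    (* The fibre of 0 may have infinite measure; both sides are 0. *)
    by rewrite scaler0 big1// => u /eqP ->; rewrite scaler0.
  rewrite (_ : _ @^-1` _ = p @^-1` [set u | h u == v]); last first.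
    by apply/seteqP; split => x /= /eqP.
  rewrite mu_finite_preimage//.
  rewrite -sum_fine; last first.
    move=> u /eqP huv; rewrite ge0_fin_numE//; apply: hfin.
    by rewrite huv.
  rewrite raddf_sum scaler_suml; apply: eq_bigr => u /eqP -> //.
under eq_bigr do rewrite step.
rewrite (exchange_big_dep xpredT)//=; apply: eq_big_seq => u uE.
rewrite big_mkcond (bigD1_seq (h u)) ?hE ?fset_uniq//= eqxx.
by rewrite big1 ?addr0// => v; rewrite eq_sym => /negPf ->.
Qed.

End FiniteMaps.

(** * Integrals of nonnegative functions that need not be measurable *)

Section LowerIntegral.
Context {R : realType} {d : measure_display} {T : measurableType d}.
Variable mu : {measure set T -> \bar R}.
Local Open Scope ereal_scope.
Import HBNNSimple.

Lemma le_lower_integral (F G : T -> \bar R) :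
  (forall x, 0 <= F x) -> (forall x, F x <= G x) ->
  \int[mu]_x F x <= \int[mu]_x G x.
Proof.
move=> F0 FG; have G0 x : 0 <= G x by exact: le_trans (F0 x) (FG x).
rewrite !ge0_integralTE//; apply: le_ereal_sup => _ [h hF <-].
by exists h => // x; exact: le_trans (hF x) (FG x).
Qed.

Lemma lower_integral_scale_le (c : R) (F : T -> \bar R) : (0 < c)%R ->
  (forall x, 0 <= F x) ->
  \int[mu]_x (c%:E * F x) <= c%:E * \int[mu]_x F x.
Proof.
move=> c0 F0.
have cF0 x : 0 <= c%:E * F x by rewrite mule_ge0// lee_fin ltW.
rewrite !ge0_integralTE//; apply: ge_ereal_sup => _ [h hF <-].
have ci0 : (0 <= c^-1)%R by rewrite invr_ge0 ltW.
rewrite -lee_pdivrMl// -sintegralrM.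
apply: ereal_sup_ubound; exists (scale_nnsfun h ci0) => // x.
rewrite /= EFinM lee_pdivrMl//; exact: hF.
Qed.

(** The half of almost everywhere monotonicity that survives when only the
    smaller function is measurable: it may be set to 0 on a null set without
    changing its integral, and then lies below the other one everywhere. *)
Lemma lower_integral_ae_ge (F G : T -> \bar R) :
  measurable_fun [set: T] F -> (forall x, 0 <= F x) -> (forall x, 0 <= G x) ->
  {ae mu, forall x, F x <= G x} ->
  \int[mu]_x F x <= \int[mu]_x G x.
Proof.
move=> mF F0 G0 [N [mN muN FG]].
rewrite (ge0_negligible_integral mN measurableT mF _ muN)// integral_mkcond.
apply: le_lower_integral => x; rewrite /patch; case: ifPn => // xN.
apply: contrapT => h; move: xN; rewrite inE => -[_]; apply; exact: FG.
Qed.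

End LowerIntegral.

(** * Integrals of simple functions *)

Section SimpleIntegral.
Context {R : realType} {d : measure_display} {T : measurableType d}.
Variable mu : {measure set T -> \bar R}.
Context {V : completeNormedModType R[i]}.
Implicit Types s t : T -> V.

Lemma simple_finite_map s : simple_integrable mu s -> finite_map s.
Proof. by case. Qed.

Lemma simple_integrable_support s : simple_integrable mu s ->
  (mu (s @^-1` [set v | v != 0%R]) < +oo)%E.
Proof.
move=> hs; rewrite mu_finite_preimage; last exact: simple_finite_map hs.
by apply: lte_sum_pinfty => v v0; case: hs => _ _; apply.
Qed.

Lemma simple_integrable_of_support (W : completeNormedModType R[i])
    (q : T -> W) (B : set T) :
  finite_map q -> measurable B -> (mu B < +oo)%E ->
  (forall x, q x != 0 -> B x) -> simple_integrable mu q.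
Proof.
move=> [fq mq] mB Bfin hqB; split => // v v0.
apply: le_lt_trans Bfin; apply: le_measure; rewrite ?inE//.
by move=> x /= qx; apply: hqB; rewrite qx.
Qed.

Lemma simple_integrable_comp (W : completeNormedModType R[i]) (h : V -> W) s :
  h 0 = 0 -> simple_integrable mu s -> simple_integrable mu (h \o s).
Proof.
move=> h0 hs; have fs := simple_finite_map hs.
apply: (@simple_integrable_of_support _ _ (s @^-1` [set v | v != 0])).
- exact: finite_map_comp.
- exact: measurable_finite_map.
- exact: simple_integrable_support.
- by move=> x /=; apply: contra_neq => ->.
Qed.

Lemma simple_integrableB s t :
  simple_integrable mu s -> simple_integrable mu t ->
  simple_integrable mu (s \- t).
Proof.
move=> hs ht; have fs := simple_finite_map hs; have ft := simple_finite_map ht.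
apply: (@simple_integrable_of_support _ _
  (s @^-1` [set v | v != 0] `|` t @^-1` [set v | v != 0])).
- exact: (finite_map_comp (fun uv : V * V => uv.1 - uv.2)
    (finite_map_pair fs ft)).
- by apply: measurableU; exact: measurable_finite_map.
- apply: le_lt_trans (measureU2 _ _ _) _; try exact: measurable_finite_map.
  by rewrite lte_add_pinfty// simple_integrable_support.
- move=> x /=; have [->|] := eqVneq (s x) 0; last by left.
  by rewrite sub0r oppr_eq0; right.
Qed.

Lemma simple_integralE s : simple_integrable mu s ->
  simple_integral mu s =
  \sum_(u <- fset_set (range s)) (fine (mu (s @^-1` [set u])))%:C *: u.
Proof.
move=> [fs ms hs]; exact: (simple_integral_comp (h := id)).
Qed.

Lemma simple_integral_linear (W : completeNormedModType R[i])
    (L : {linear V -> W}) s :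
  simple_integrable mu s ->
  simple_integral mu (L \o s) = L (simple_integral mu s).
Proof.
move=> hs; rewrite simple_integralE// simple_integral_comp; first last.
- move=> u Lu; case: hs => _ _; apply.
  by apply: contra_neq Lu => ->; rewrite linear0.
- exact: simple_finite_map hs.
by rewrite linear_sum; apply: eq_bigr => u _; rewrite linearZ.
Qed.

Lemma simple_integralB s t :
  simple_integrable mu s -> simple_integrable mu t ->
  simple_integral mu (s \- t) = simple_integral mu s - simple_integral mu t.
Proof.
move=> hs ht; have fs := simple_finite_map hs; have ft := simple_finite_map ht.
pose p x := (s x, t x); have fp : finite_map p by exact: finite_map_pair.
have hfin (uv : V * V) : uv != 0 -> (mu (p @^-1` [set uv]) < +oo)%E.
  case: uv => u v uv0.
  have [u0|u0] := eqVneq u 0; last first.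
    case: hs => _ _ /(_ u u0); apply: le_lt_trans; apply: le_measure.
    - by rewrite inE; case: fp.
    - by rewrite inE; case: fs.
    - by move=> x [].
  have v0 : v != 0 by apply: contra_neq uv0 => ->; rewrite u0.
  case: ht => _ _ /(_ v v0); apply: le_lt_trans; apply: le_measure.
  - by rewrite inE; case: fp.
  - by rewrite inE; case: ft.
  - by move=> x [].
have E (h : V * V -> V) : h 0 = 0 -> simple_integral mu (h \o p) =
    \sum_(u <- fset_set (range p)) (fine (mu (p @^-1` [set u])))%:C *: h u.
  move=> h0; apply: simple_integral_comp => // u hu; apply: hfin.
  by apply: contra_neq hu => ->.
rewrite (E (fun uv => uv.1 - uv.2)) ?subr0// (E fst)// (E snd)//.
by rewrite -sumrB; apply: eq_bigr => u _; rewrite scalerBr.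
Qed.

Lemma integral_rnorm_simple s : simple_integrable mu s ->
  (\int[mu]_x (rnorm (s x))%:E =
   \sum_(u <- fset_set (range s)) (rnorm u)%:E * mu (s @^-1` [set u]))%E.
Proof.
move=> hs; have [fs ms _] := hs.
transitivity (\int[mu]_x (\sum_(u <- fset_set (range s))
   (rnorm u)%:E * (\1_(s @^-1` [set u]) x)%:E))%E.
  apply: eq_integral => x _.
  rewrite (bigD1_seq (s x)) ?fset_uniq//=; last first.
    by rewrite in_fset_set// inE; exists x.
  rewrite indicE mem_set// mule1 big1 ?adde0// => u us.
  rewrite indicE memNset ?mule0//= => h.
  by rewrite h eqxx in us.
rewrite ge0_integral_sum//.
- apply: eq_bigr => u _; rewrite ge0_integralZl//.
  + by rewrite integral_indic// setIT.
  + by apply/measurable_EFinP; exact: measurable_indic.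
  + by rewrite lee_fin rnorm_ge0.
- move=> u; apply: measurable_funeM.
  by apply/measurable_EFinP; exact: measurable_indic.
- by move=> u x _; rewrite mule_ge0// lee_fin ?rnorm_ge0.
Qed.

Lemma rnorm_simple_integral s : simple_integrable mu s ->
  ((rnorm (simple_integral mu s))%:E <= \int[mu]_x (rnorm (s x))%:E)%E.
Proof.
move=> hs; rewrite integral_rnorm_simple// simple_integralE//.
apply: (@le_trans _ _ (\sum_(u <- fset_set (range s))
    (fine (mu (s @^-1` [set u])) * rnorm u)%:E)%E).
  rewrite sumEFin lee_fin; apply: le_trans (ler_rnorm_sum _ _) _.
  by apply: ler_sum => u _; rewrite rnormZ ger0_norm// fine_ge0.
apply: lee_sum => u _; rewrite EFinM muleC.
apply: lee_wpmul2l; first by rewrite lee_fin rnorm_ge0.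
have fine_le (z : \bar R) : (0 <= z -> (fine z)%:E <= z)%E.
  by case: z => //= _; rewrite leey.
exact/fine_le/measure_ge0.
Qed.

Lemma measurable_rnorm_simple s : simple_integrable mu s ->
  measurable_fun [set: T] (fun x => (rnorm (s x))%:E).
Proof.
move=> hs _ Y mY; rewrite setTI.
exact: (measurable_finite_map ((fun v => (rnorm v)%:E) @^-1` Y)
  (simple_finite_map hs)).
Qed.

End SimpleIntegral.

(** * The Bochner integral is well defined *)

Section BochnerIntegral.
Context {R : realType} {d : measure_display} {T : measurableType d}.
Variable mu : {measure set T -> \bar R}.
Context {V : completeNormedModType R[i]}.
Implicit Types (f s t : T -> V).

(** The upper limit of |u_n - s| along simple u_n tending to f almost
    everywhere is measurable on the whole space, whereas |f - s| need not be.
    The absolute value gives nonnegativity at once, also where u_n diverges. *)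
Lemma strongly_measurable_dist f s :
  strongly_measurable mu f -> simple_integrable mu s ->
  exists F : T -> \bar R,
    [/\ measurable_fun [set: T] F, (forall x, 0 <= F x)%E &
        {ae mu, forall x, F x = (rnorm (f x - s x))%:E}].
Proof.
move=> [u hu uf] hs.
exists (fun x => `|limn_esup (fun n => (rnorm (u n x - s x))%:E)|%E); split.
- apply: measurableT_comp => //; apply: measurable_fun_limn_esup => n.
  exact: measurable_rnorm_simple (simple_integrableB (hu n) hs).
- by move=> x; exact: abse_ge0.
apply: filterS uf => x /cvg_rnormP uf.
suff h : (rnorm (u n x - s x))%:E @[n --> \oo] --> (rnorm (f x - s x))%:E.
  by rewrite (cvg_limn_einf_sup h).2 /= ger0_norm ?rnorm_ge0.
apply: cvg_EFin; first by near=> n.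
move/cvgrPdist_lt: uf => uf; apply/cvgrPdist_lt => e /uf; apply: filterS => n.
rewrite sub0r normrN ger0_norm ?rnorm_ge0//; apply: le_lt_trans.
apply: le_trans (rnorm_dist _ _) _.
by rewrite opprB addrA subrK.
Unshelve. all: by end_near.
Qed.

(** Subadditivity is applied to the measurable versions of |f - s| and |f - t|,
    whose integrals are then compared with the lower integrals. *)
Lemma L1_dist f s t : strongly_measurable mu f ->
  simple_integrable mu s -> simple_integrable mu t ->
  (\int[mu]_x (rnorm (s x - t x))%:E <=
   \int[mu]_x (rnorm (f x - s x))%:E + \int[mu]_x (rnorm (f x - t x))%:E)%E.
Proof.
move=> mf hs ht.
have [F [mF F0 Ff]] := strongly_measurable_dist mf hs.
have [G [mG G0 Gf]] := strongly_measurable_dist mf ht.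
apply: (@le_trans _ _ (\int[mu]_x (F x + G x))%E).
  apply: lower_integral_ae_ge.
  - exact: measurable_rnorm_simple (simple_integrableB hs ht).
  - by move=> x; rewrite lee_fin rnorm_ge0.
  - by move=> x; rewrite adde_ge0.
  apply: filterS2 Ff Gf => x -> ->; rewrite -EFinD lee_fin.
  rewrite -(subrK (f x) (s x)) -addrA.
  by apply: le_trans (ler_rnormD _ _) _; rewrite rnorm_sub subrK.
rewrite ge0_integralD//; apply: leeD; apply: lower_integral_ae_ge => //;
  try by move=> x; rewrite lee_fin rnorm_ge0.
- by apply: filterS Ff => x ->.
- by apply: filterS Gf => x ->.
Qed.

Lemma simple_integral_dist f s t : strongly_measurable mu f ->
  simple_integrable mu s -> simple_integrable mu t ->
  ((rnorm (simple_integral mu s - simple_integral mu t))%:E <=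
   \int[mu]_x (rnorm (f x - s x))%:E + \int[mu]_x (rnorm (f x - t x))%:E)%E.
Proof.
move=> mf hs ht; rewrite -simple_integralB//.
apply: le_trans (rnorm_simple_integral (simple_integrableB hs ht)) _.
exact: L1_dist.
Qed.

(** The L1 distances to [f] may be infinite for small indices, hence [N]. *)
Lemma L1_approx_dist f (s t : nat -> T -> V) : strongly_measurable mu f ->
  L1_approx mu f s -> L1_approx mu f t ->
  exists N (a b : nat -> R),
  [/\ a n @[n --> \oo] --> 0, b n @[n --> \oo] --> 0 &
    forall n m, (N <= n)%N -> (N <= m)%N ->
      rnorm (simple_integral mu (s n) - simple_integral mu (t m)) <= a n + b m].
Proof.
move=> mf [hs /fine_cvgP[sfin sf]] [ht /fine_cvgP[tfin tf]].
have [N _ hN] := filterI sfin tfin; exists N.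
exists (fine \o (fun n => \int[mu]_x (rnorm (f x - s n x))%:E)%E),
  (fine \o (fun n => \int[mu]_x (rnorm (f x - t n x))%:E)%E); split => //.
move=> n m /hN[sn _] /hN[_ tm].
rewrite -lee_fin EFinD /= !fineK//.
exact: simple_integral_dist.
Qed.

Lemma L1_approx_cvg f (s : nat -> T -> V) :
  strongly_measurable mu f -> L1_approx mu f s ->
  cvgn (fun n => simple_integral mu (s n)).
Proof.
move=> mf fs; have [N [a [b [a0 b0 h]]]] := L1_approx_dist mf fs fs.
apply: (@cauchy_rnorm_cvg _ _ _ (fun n => `|a n| + `|b n|) N).
  rewrite -[X in _ --> X](addr0 (0 : R)) -[X in X + X](normr0 R).
  by apply: cvgD; exact: cvg_norm.
move=> n m hn hm; apply: le_trans (h n m hn hm) _.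
apply: lerD; first by apply: le_trans (ler_norm _) _; rewrite lerDl.
by apply: le_trans (ler_norm _) _; rewrite lerDr.
Qed.

Lemma L1_approx_lim_unique f (s t : nat -> T -> V) (v w : V) :
  strongly_measurable mu f ->
  L1_approx mu f s -> L1_approx mu f t ->
  simple_integral mu (s n) @[n --> \oo] --> v ->
  simple_integral mu (t n) @[n --> \oo] --> w ->
  v = w.
Proof.
move=> mf fs ft sv tw; have [N [a [b [a0 b0 h]]]] := L1_approx_dist mf fs ft.
have ab0 : (a n + b n) @[n --> \oo] --> (0 : R).
  by rewrite -[X in _ --> X](addr0 (0 : R)); exact: cvgD.
have d0 : (simple_integral mu (t n) - simple_integral mu (s n))
    @[n --> \oo] --> (0 : V).
  apply/cvg_rnormP.
  apply: (@squeeze_cvgr _ _ _ _ (cst 0) _ _ _ _ _ ab0); last exact: cvg_cst.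
  exists N => // n /= hn.
  by apply/andP; split; [exact: rnorm_ge0|rewrite sub0r opprB; exact: h].
have d1 : (simple_integral mu (t n) - simple_integral mu (s n))
    @[n --> \oo] --> (w - v).
  exact: cvgB.
apply/esym/eqP; rewrite -subr_eq0; apply/eqP.
exact: (cvg_unique _ d1 d0).
Qed.

Lemma bochner_integral_eq f (s : nat -> T -> V) (v : V) :
  strongly_measurable mu f -> L1_approx mu f s ->
  simple_integral mu (s n) @[n --> \oo] --> v -> bochner_integral mu f = v.
Proof.
move=> mf fs sv; rewrite /bochner_integral.
case: xgetP => [w _ [t ft tw]|/(_ v)[]]; last by exists s.
exact: L1_approx_lim_unique mf ft fs tw sv.
Qed.

End BochnerIntegral.

(** * Bounded linear maps and the Bochner integral *)

Section BoundedLinear.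
Context {R : realType} {d : measure_display} {T : measurableType d}.
Variable mu : {measure set T -> \bar R}.
Context {V W : completeNormedModType R[i]}.

Lemma bochner_integral_linear (L : {linear V -> W}) (C : R) (f : T -> V) :
  0 < C -> (forall v, rnorm (L v) <= C * rnorm v) ->
  bochner_integrable mu f ->
  bochner_integral mu (L \o f) = L (bochner_integral mu f).
Proof.
move=> C0 LC [mf [s fs]].
have Lcvg (u : nat -> V) (v : V) :
    u n @[n --> \oo] --> v -> L (u n) @[n --> \oo] --> L v.
  move=> /cvg_rnormP uv; apply/cvg_rnormP.
  apply: (@squeeze_cvgr _ _ _ _ (cst 0) (fun n => C * rnorm (v - u n))).
  - by near=> n; rewrite rnorm_ge0 -linearB LC.
  - exact: cvg_cst.
  - by rewrite -[X in _ --> X](mulr0 C); apply: cvgM => //; exact: cvg_cst.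
have sLs (u : T -> V) :
    simple_integrable mu u -> simple_integrable mu (L \o u).
  by apply: simple_integrable_comp; exact: linear0.
have /cvg_ex[w sw] := L1_approx_cvg mf fs.
rewrite (bochner_integral_eq mf fs sw).
apply: (@bochner_integral_eq _ _ _ mu W (L \o f) (fun n => L \o s n) (L w)).
- case: mf => u hu uf; exists (fun n => L \o u n).
    by move=> n; exact: sLs.
  by apply: filterS uf => x; exact: Lcvg.
- case: fs => hs sf; split; first by move=> n; exact: sLs.
  have Csf : (C%:E * \int[mu]_x (rnorm (f x - s n x))%:E)%E
      @[n --> \oo] --> 0%E.
    by rewrite -(mule0 C%:E); apply: cvgeM => //; exact: cvg_cst.
  apply: squeeze_cvge Csf; last exact: cvg_cst.
  near=> n; rewrite integral_ge0; last by move=> x _; rewrite lee_fin rnorm_ge0.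
  apply: le_trans (lower_integral_scale_le mu C0 _); last first.
    by move=> x; rewrite lee_fin rnorm_ge0.
  apply: le_lower_integral => x; rewrite ?lee_fin ?rnorm_ge0//.
  by rewrite -linearB LC.
- rewrite (_ : (fun n => _) = fun n => L (simple_integral mu (s n))).
    exact: Lcvg.
  by apply/funext => n; exact: simple_integral_linear (fs.1 n).
Unshelve. all: by end_near.
Qed.

End BoundedLinear.

(** * Boundedness of the inner product *)

Section InnerProduct.
Context {R : realType} {A : cstarAlgType R} {H : hilbertModType A}.
Implicit Types x y z : H.

Lemma innerZl (l : R[i]) x y : inner (l *: x) y = l *: inner x y.
Proof.
by rewrite -{1}(hact1 x) -hactZ inner_hact -ascaleAl amul1l.
Qed.

(** A named function, so that it can carry the structure of a linear map. *)
Definition innerl y x : A := inner x y.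

Lemma innerl_is_linear y : linear (innerl y).
Proof. by move=> l x z; rewrite /innerl innerDl innerZl. Qed.

HB.instance Definition _ y :=
  GRing.isLinear.Build R[i] H A *:%R (innerl y) (innerl_is_linear y).

Lemma innerDr x y z : inner x (y + z) = inner x y + inner x z.
Proof. by rewrite -inner_star innerDl starD !inner_star. Qed.

Lemma innerZr (l : R[i]) x y : inner x (l *: y) = Num.conj l *: inner x y.
Proof. by rewrite -inner_star innerZl starZ inner_star. Qed.

Lemma rnorm_inner_self x : rnorm (inner x x) = rnorm x ^+ 2.
Proof. by apply: (@complexI R); rewrite rmorphXn /= -!rnormE hnormE. Qed.

(** The sum is <x + y, x + y> - <x, x> - <y, y>, and the norm of each of these
    terms is the square of a norm of H. *)
Lemma rnorm_innerDC x y :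
  rnorm (inner x y + inner y x) <= 2 * (rnorm x + rnorm y) ^+ 2.
Proof.
have -> : inner x y + inner y x =
    inner (x + y) (x + y) - (inner x x + inner y y).
  rewrite innerDl !innerDr opprD addrACA [inner x x + _]addrC addrK.
  by rewrite addrK.
apply: le_trans (ler_rnormD _ _) _.
rewrite rnormN; have := ler_rnormD (inner x x) (inner y y).
rewrite !rnorm_inner_self.
have xy2 : rnorm (x + y) ^+ 2 <= (rnorm x + rnorm y) ^+ 2.
  by rewrite ler_sqr ?nnegrE ?addr_ge0 ?rnorm_ge0// ler_rnormD.
have := rnorm_ge0 x; have := rnorm_ge0 y; nra.
Qed.

(** Twice <x, y> is the sum of <x, y> + <y, x> and of -i times the same
    expression for i x and y. *)
Lemma inner_bounded_add x y : rnorm (inner x y) <= 2 * (rnorm x + rnorm y) ^+ 2.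
Proof.
have two : (2 : R)%:C = 2 by exact: (rmorph_nat (real_complex R) 2).
have E : (2 : R)%:C *: inner x y =
    (inner x y + inner y x) - 'i *: (inner ('i *: x) y + inner y ('i *: x)).
  rewrite innerZl innerZr scalerDr !scalerA conjCi mulrN -expr2 sqrCi opprK.
  rewrite two scaler_nat mulr2n scaleN1r scale1r.
  by rewrite opprD opprK addrACA subrr addr0.
have /(congr1 (@rnorm R A)) := E; rewrite rnormZ ger0_norm// => /esym h.
have := rnorm_innerDC x y; have := rnorm_innerDC ('i *: x) y; rewrite rnorm_iZ.
have := ler_rnormD (inner x y + inner y x)
  (- ('i *: (inner ('i *: x) y + inner y ('i *: x)))).
rewrite h rnormN rnorm_iZ.
lra.
Qed.

(** For x of norm 1 the previous bound depends on y only; homogeneity does the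
    rest. *)
Lemma inner_bounded y :
  exists2 C : R, 0 < C & forall x, rnorm (inner x y) <= C * rnorm x.
Proof.
exists (2 * (1 + rnorm y) ^+ 2).
  by rewrite mulr_gt0// exprn_gt0// ltr_pwDl// rnorm_ge0.
move=> x; have [->|x0] := eqVneq x 0.
  by rewrite rnorm0 mulr0 -[inner _ _]/(innerl y 0) linear0 rnorm0.
have rx0 : 0 < rnorm x by rewrite -ltcR -rnormE normr_gt0.
have := inner_bounded_add ((rnorm x)^-1%:C *: x) y.
rewrite innerZl !rnormZ ger0_norm ?invr_ge0 ?rnorm_ge0// mulVf ?gt_eqF//.
by rewrite ler_pdivrMl// mulrC.
Qed.

End InnerProduct.

(** * The biframe operator *)

Section BiframeOperator.
Context {R : realType} {A : cstarAlgType R} {H : hilbertModType A}.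
Context {d : measure_display} {Omega : measurableType d}.
Variable mu : {measure set Omega -> \bar R}.

Lemma inner_biframe_operator (X Y : Omega -> H) (S : H -> H) :
  is_biframe_operator mu X Y S -> forall f,
  inner (S f) f = bochner_integral mu (biframe_integrand X Y f).
Proof.
move=> hS f; have [iS ->] := hS f; have [C C0 hC] := inner_bounded f.
rewrite -[LHS]/(innerl f _) -(bochner_integral_linear (L := innerl f) C0 hC iS).
by congr bochner_integral; apply/funext => w; rewrite /= /innerl inner_hact.
Qed.

End BiframeOperator.

Theorem theorem2p7 (R : realType) (A : cstarAlgType R) (H : hilbertModType A)
    (d : measure_display) (Omega : measurableType d)
    (mu : {measure set Omega -> \bar R})
    (X Y : Omega -> H) (a b : R) (S : H -> H)
    (hBessel : is_biframe_bessel mu X Y b)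
    (ha : 0 < a) (hab : a <= b)
    (hS : is_biframe_operator mu X Y S) :
  is_biframe mu X Y a b <-> operator_ge_scalar S a.
Proof.
have SE := inner_biframe_operator hS.
case: hBessel => _ mX mY Bessel; split.
  by move=> [_ _ _ frame] f; rewrite SE; case: (frame f).
move=> Sa; split=> // [|f]; first by rewrite ha.
by have [int_f le_b] := Bessel f; split=> //; rewrite -SE; exact: Sa.
Qed.
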